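(* Let $n\ge 2$, $1\le\ell\le n$, and let $G_1,\ldots,G_n$ be finite connected vertex-transitive graphs with \[\tfrac12\geq\frac{\alpha(G_1)}{|V(G_1)|}=\cdots=\frac{\alpha(G_\ell)}{|V(G_\ell)|}>\frac{\alpha(G_{\ell+1})}{|V(G_{\ell+1})|}\geq\cdots\geq\frac{\alpha(G_n)}{|V(G_n)|}.\] Then $G_1\times G_2\times\cdots\times G_n$ is MIS-normal if and only if one of the following holds: (i) $\frac{\alpha(G_1)}{|V(G_1)|}<\frac12$ and, whenever $\ell>1$, the graphs $G_1,\ldots,G_\ell$ are all IS-primitive; (ii) $\frac{\alpha(G_1)}{|V(G_1)|}=\frac12$ and $\ell\le 2$.
   Context: All graphs are finite and simple; $\alpha(\cdot)$ is the independence number. The direct product $G\times H$ has vertex set $V(G)\times V(H)$, with $(u_1,v_1)\sim(u_2,v_2)$ iff $u_1u_2\in E(G)$ and $v_1v_2\in E(H)$. A product $G_1\times\cdots\times G_n$ is MIS-normal if every maximum independent set of it is the preimage, under the projection onto some factor $G_i$, of an independent set of $G_i$. For $A\subseteq V(G)$, $N_G(A)=\{b: ab\in E(G)\text{ for some }a\in A\}$, $N_G[A]=N_G(A)\cup A$. A (nonempty) independent set $A$ of $G$ is imprimitive if $|A|<\alpha(G)$ and $\frac{|A|}{|N_G[A]|}=\frac{\alpha(G)}{|V(G)|}$; $G$ is IS-imprimitive if it has an imprimitive independent set and IS-primitive otherwise. *)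

(* Defs.v *)
From mathcomp Require Import all_boot all_order all_algebra all_fingroup.
Set Implicit Arguments. Unset Strict Implicit. Unset Printing Implicit Defensive.
Import GRing.Theory Num.Theory.

Definition simple_graph (T : finType) (e : rel T) : Prop :=
  symmetric e /\ irreflexive e.

Definition connected_graph (T : finType) (e : rel T) : Prop :=
  forall x y : T, connect e x y.

Definition is_graph_aut (T : finType) (e : rel T) (f : {perm T}) : Prop :=
  forall u v : T, e (f u) (f v) = e u v.

Definition vertex_transitive (T : finType) (e : rel T) : Prop :=
  forall x y : T, exists f : {perm T}, is_graph_aut e f /\ f x = y.

Definition independent (T : finType) (e : rel T) (A : {set T}) : bool :=
  [forall x in A, forall y in A, ~~ e x y].

Definition alpha (T : finType) (e : rel T) : nat :=
  \max_(A : {set T} | independent e A) #|A|.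

Definition max_independent (T : finType) (e : rel T) (A : {set T}) : bool :=
  independent e A && (#|A| == alpha e).

Definition indep_ratio (T : finType) (e : rel T) : rat :=
  (alpha e)%:R / #|T|%:R.

Definition nbhd (T : finType) (e : rel T) (A : {set T}) : {set T} :=
  [set b | [exists a in A, e a b]].

Definition cnbhd (T : finType) (e : rel T) (A : {set T}) : {set T} :=
  nbhd e A :|: A.

Definition imprimitive (T : finType) (e : rel T) (A : {set T}) : Prop :=
  [/\ A != set0, independent e A, #|A| < alpha e &
      (#|A|%:R / #|cnbhd e A|%:R : rat) = indep_ratio e].

Definition IS_imprimitive (T : finType) (e : rel T) : Prop :=
  exists A : {set T}, imprimitive e A.

Definition IS_primitive (T : finType) (e : rel T) : Prop :=
  ~ IS_imprimitive e.

Definition prod_vertex (n : nat) (T : 'I_n -> finType) : finType :=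
  {dffun forall i : 'I_n, T i}.

Definition prod_rel (n : nat) (T : 'I_n -> finType) (E : forall i, rel (T i))
  : rel (prod_vertex T) :=
  fun u v => [forall i : 'I_n, E i (u i) (v i)].

Definition MIS_normal (n : nat) (T : 'I_n -> finType) (E : forall i, rel (T i))
  : Prop :=
  forall S : {set prod_vertex T}, max_independent (prod_rel E) S ->
    exists i : 'I_n, exists I : {set T i},
      independent (E i) I /\ S = [set x : prod_vertex T | x i \in I].

(* Main.v *)
Require Import Defs.
From mathcomp Require Import all_boot all_order all_algebra all_fingroup.
From mathcomp Require Import zify ring lra.
Set Implicit Arguments. Unset Strict Implicit. Unset Printing Implicit Defensive.
Import Order.TTheory GRing.Theory Num.Theory.

(** Write r(G) for the independence ratio.  Averaging over automorphisms shows
    that an independent set A of a vertex-transitive graph G satisfies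
    |A| <= r(G) |N[A]|, and that in case of equality A may replace the part of
    any maximum independent set lying in N[A].

    Let S be independent in G x H.  Splitting each fibre of S over G into its
    isolated vertices and the rest gives independent sets of H indexed by G and
    independent sets of G indexed by H whose closed neighbourhoods tile disjoint
    parts of G x H; hence r(G x H) = max (r(G), r(H)).  When S is maximum the
    tiling is perfect: if r(H) < r(G) and H is connected, or if r(H) = r(G) and
    both factors are connected and IS-primitive, S is a preimage.  If moreover
    r(G) < 1/2, the product is again IS-primitive, hence connected, and the
    argument iterates.  A connected graph of ratio 1/2 is always IS-primitive,
    which settles two bipartite factors.

    Conversely an imprimitive set A of G and a maximum independent set M of H
    give the non-normal set (A x H) u ((G \ N[A]) x M), and three bipartite
    factors give the set of vertices a majority of whose coordinates lie in
    chosen colour classes. *)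

(** * Independent sets, closed neighbourhoods and the independence ratio *)

Section IndependentSets.
Variables (T : finType) (e : rel T).

Lemma independentP (A : {set T}) :
  reflect {in A &, forall x y, ~~ e x y} (independent e A).
Proof.
apply: (iffP forall_inP) => [H x y xA yA | H x xA].
  exact: (forall_inP (H x xA)) y yA.
by apply/forall_inP => y yA; apply: H.
Qed.

Lemma leq_alpha (A : {set T}) : independent e A -> #|A| <= alpha e.
Proof. exact: leq_bigmax_cond. Qed.

Lemma alpha_witness : exists M, max_independent e M.
Proof.
have i0 : independent e set0 by apply/independentP => x y; rewrite inE.
have [M iM aM] : {M | independent e M & alpha e = #|M|}.
  by apply: eq_bigmax_cond; apply/card_gt0P; exists set0.
by exists M; rewrite /max_independent iM aM eqxx.
Qed.

Lemma alpha_gt0 : irreflexive e -> 0 < #|T| -> 0 < alpha e.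
Proof.
move=> irr /card_gt0P[x _]; rewrite -(cards1 x); apply: leq_alpha.
by apply/independentP => y z /set1P-> /set1P->; rewrite irr.
Qed.

Lemma nbhdP (A : {set T}) y :
  reflect (exists2 x, x \in A & e x y) (y \in nbhd e A).
Proof. by rewrite inE; apply: exists_inP. Qed.

Lemma sub_cnbhd (A : {set T}) : A \subset cnbhd e A.
Proof. exact: subsetUr. Qed.

Lemma sub_independent (A B : {set T}) :
  A \subset B -> independent e B -> independent e A.
Proof.
move=> /subsetP sAB /independentP iB; apply/independentP => x y xA yA.
by apply: iB; apply: sAB.
Qed.

(** The exchange move: vertices of A have no neighbour outside N[A], so A may replace whatever M has
    inside N[A]. *)
Lemma independentU_cnbhdC (A M : {set T}) : symmetric e ->
  independent e A -> independent e M -> independent e (A :|: (M :\: cnbhd e A)).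
Proof.
move=> sym /independentP iA /independentP iM.
have far x y : x \in A -> y \notin cnbhd e A -> ~~ e x y.
  move=> xA; apply: contra => exy; rewrite inE; apply/orP; left.
  by apply/nbhdP; exists x.
apply/independentP => x y /setUP[xA|/setDP[xM xN]] /setUP[yA|/setDP[yM yN]].
- exact: iA.
- exact: far.
- by rewrite sym; apply: far.
- exact: iM.
Qed.

Lemma card_independentU_cnbhdC (A M : {set T}) :
  #|A :|: (M :\: cnbhd e A)| = #|A| + #|M :\: cnbhd e A|.
Proof.
rewrite cardsU (_ : A :&: _ = set0) ?cards0 ?subn0 //.
apply/setP => x; rewrite !inE; case: (x \in A) => //=.
by rewrite orbT.
Qed.

Lemma indep_ratioE : 0 < #|T| ->
  ((alpha e)%:R = indep_ratio e * #|T|%:R :> rat)%R.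
Proof. by move=> T0; rewrite /indep_ratio divfK // pnatr_eq0 -lt0n. Qed.

Lemma indep_ratio_gt0 : irreflexive e -> 0 < #|T| -> (0 < indep_ratio e)%R.
Proof.
by move=> irr T0; rewrite /indep_ratio divr_gt0 // ltr0n // alpha_gt0.
Qed.

Lemma max_independent_card (M : {set T}) : 0 < #|T| -> independent e M ->
  max_independent e M = (#|M|%:R == indep_ratio e * #|T|%:R :> rat)%R.
Proof.
by move=> T0 iM; rewrite /max_independent iM -indep_ratioE // eqr_nat.
Qed.

End IndependentSets.

(** * Averaging over the automorphism group *)

Section Averaging.
Variables (T : finType) (e : rel T).
Hypothesis vt : vertex_transitive e.

Definition graph_auts : {set {perm T}} :=
  [set g : {perm T} | [forall u, forall v, e (g u) (g v) == e u v]].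

Lemma graph_autsP (g : {perm T}) : reflect (is_graph_aut e g) (g \in graph_auts).
Proof.
rewrite inE; apply: (iffP forallP) => [H u v | H u].
  exact/eqP/(forallP (H u)).
by apply/forallP => v; rewrite H.
Qed.

Lemma preim_independent (g : {perm T}) (M : {set T}) :
  g \in graph_auts -> independent e M -> independent e (g @^-1: M).
Proof.
move=> /graph_autsP ag /independentP iM; apply/independentP => x y.
by rewrite !inE => xM yM; rewrite -ag iM.
Qed.

Let transporter x y := [set g : {perm T} in graph_auts | g x == y].

(** Composing with automorphisms sending x to x' and y' to y embeds one transporter into the other,
    so all transporters have the same size. *)
Let transporter_le x y x' y' : #|transporter x' y'| <= #|transporter x y|.
Proof.
have [a [aa ax]] := vt x x'; have [b [ab bx]] := vt y' y.
rewrite -(card_imset (mem (transporter x' y')) (mulgI a)).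
rewrite -(card_imset _ (mulIg b)).
apply/subset_leq_card/subsetP => _ /imsetP[_ /imsetP[g + ->] ->].
rewrite !inE => /andP[/forallP ag /eqP gx].
rewrite !permM ax gx bx eqxx andbT; apply/forallP => u; apply/forallP => v.
by rewrite !permM ab (eqP (forallP (ag _) _)) aa.
Qed.

(** Double counting of the pairs (g, x) with x in B and g x in M: any two points are joined by the
    same number c of automorphisms, and their total number is c |T|. *)
Lemma sum_card_preim_auts (M B : {set T}) :
  (\sum_(g in graph_auts) #|g @^-1: M :&: B|) * #|T|
    = #|graph_auts| * (#|M| * #|B|).
Proof.
have [T0|/card_gt0P[x0 _]] := posnP #|T|.
  by have := max_card M; rewrite T0 leqn0 => /eqP ->; rewrite !muln0.
set c := #|transporter x0 x0|.
have tE x y : #|transporter x y| = c.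
  by apply/eqP; rewrite eqn_leq !transporter_le.
have cardG (x : T) (M' : {set T}) :
    \sum_(g in graph_auts) (g x \in M') = c * #|M'|.
  rewrite (eq_bigr (fun g : {perm T} => \sum_(y in M') (g x == y))); last first.
    move=> g _; case: (boolP (g x \in M')) => [gM|gM].
      by rewrite (bigD1 (g x)) //= eqxx big1 // => y /andP[_ /negPf]; rewrite eq_sym => ->.
    rewrite big1 // => y yM; apply/eqP; rewrite eqb0; apply: contra gM => /eqP -> //.
  rewrite exchange_big /= (eq_bigr (fun _ => c)) ?sum_nat_const ?[c * _]mulnC //.
  move=> y _; rewrite -(tE x y) -sum1_card [RHS](eq_bigl _ _ (fun g => in_set _ _)).
  by rewrite -big_mkcondr.
have -> : #|graph_auts| = c * #|T|.
  rewrite -cardsT -(cardG x0) -sum1_card; apply: eq_bigr => g _.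
  by rewrite inE.
rewrite (eq_bigr (fun g : {perm T} => \sum_(x in B) (g x \in M))); last first.
  by move=> g _; rewrite -big_mkcondr -sum1_card; apply: eq_bigl => x; rewrite !inE andbC.
rewrite exchange_big /= (eq_bigr (fun _ => c * #|M|)) => [|x _]; last exact: cardG.
by rewrite sum_nat_const; ring.
Qed.

Lemma graph_auts1 : 1%g \in graph_auts.
Proof. by apply/graph_autsP => u v; rewrite !perm1. Qed.

Lemma card_auts_gt0 : 0 < #|graph_auts|.
Proof. by apply/card_gt0P; exists 1%g; rewrite graph_auts1. Qed.

Lemma average_le (M B : {set T}) b :
  {in graph_auts, forall g : {perm T}, #|g @^-1: M :&: B| <= b} ->
  #|M| * #|B| <= b * #|T|.
Proof.
move=> Hb; rewrite -(leq_pmul2l card_auts_gt0) -sum_card_preim_auts.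
rewrite mulnA leq_mul2r; apply/orP; right.
by rewrite -sum_nat_const; apply: leq_sum.
Qed.

(** The mean over g of the left-hand sizes is |M| |B| / |T|; if a mean attains a uniform upper
    bound, so does every term, in particular the one for g = 1. *)
Lemma average_eq (M B : {set T}) b : 0 < #|T| ->
  {in graph_auts, forall g : {perm T}, #|g @^-1: M :&: B| <= b} ->
  #|M| * #|B| = b * #|T| -> #|M :&: B| = b.
Proof.
move=> T0 Hb Heq.
have /eqP : (\sum_(g in graph_auts) #|g @^-1: M :&: B|) * #|T|
             = (\sum_(g in graph_auts) b) * #|T|.
  by rewrite sum_card_preim_auts Heq sum_nat_const mulnA.
rewrite eqn_pmul2r //.
have := @leqif_sum _ (mem graph_auts) _ _ _
  (fun g gA => leqif_eq (Hb g gA)).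
move=> [_ ->] /forall_inP /(_ _ graph_auts1) /eqP <-.
by congr #|pred_of_set (_ :&: _)|; apply/setP => x; rewrite inE perm1.
Qed.

End Averaging.

(** * The bound |A| <= r |N[A]| and its equality case *)

Section ClosedNeighbourhoods.
Variables (T : finType) (e : rel T).
Hypotheses (sg : simple_graph e) (vt : vertex_transitive e) (T0 : 0 < #|T|).

Let sum_le (A M : {set T}) : independent e A -> independent e M ->
  #|M :\: cnbhd e A| <= alpha e - #|A|.
Proof.
move=> iA iM; have := leq_alpha (independentU_cnbhdC sg.1 iA iM).
by rewrite card_independentU_cnbhdC; have := leq_alpha iA; lia.
Qed.

(** By the exchange move, every translate of a maximum independent set has at most alpha - |A|
    vertices outside N[A]. Averaging over the translates, with B the complement of N[A], gives the
    inequality. *)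
Lemma card_cnbhd_nat (A : {set T}) : independent e A ->
  #|A| * #|T| <= alpha e * #|cnbhd e A|.
Proof.
move=> iA; have [M /andP[iM /eqP cM]] := alpha_witness e.
have := @average_le _ _ vt M (~: cnbhd e A) (alpha e - #|A|).
rewrite cM -(cardsC (cnbhd e A)) => H.
have {H} : alpha e * #|~: cnbhd e A| <= (alpha e - #|A|) * (#|cnbhd e A| + #|~: cnbhd e A|).
  by apply: H => g ag; rewrite -setDE sum_le // preim_independent.
by have := leq_alpha iA; nia.
Qed.

Lemma card_cnbhd (A : {set T}) : independent e A ->
  (#|A|%:R <= indep_ratio e * #|cnbhd e A|%:R :> rat)%R.
Proof.
move=> /card_cnbhd_nat; rewrite -(ler_nat rat) !natrM (indep_ratioE e T0).
by rewrite mulrAC ler_pM2r // ltr0n.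
Qed.

(** Tightness of A makes the mean size outside N[A] equal to its bound alpha - |A|, so M attains
    this bound and the exchange loses nothing. *)
Lemma max_independent_exchange (A M : {set T}) : independent e A ->
  (#|A|%:R = indep_ratio e * #|cnbhd e A|%:R :> rat)%R ->
  max_independent e M -> max_independent e (A :|: (M :\: cnbhd e A)).
Proof.
move=> iA cA /andP[iM /eqP cM].
rewrite /max_independent (independentU_cnbhdC sg.1 iA iM) /=.
have cA' : #|A| * #|T| = alpha e * #|cnbhd e A|.
  apply/eqP; rewrite -(eqr_nat rat) !natrM (indep_ratioE e T0) cA.
  by rewrite mulrAC.
rewrite card_independentU_cnbhdC setDE (@average_eq _ _ vt _ _ (alpha e - #|A|)) //.
- by rewrite subnKC // leq_alpha.
- by move=> g ag; rewrite -setDE sum_le // preim_independent.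
- by rewrite cM; have := cardsC (cnbhd e A); have := leq_alpha iA; nia.
Qed.

End ClosedNeighbourhoods.

(** * Direct products of two graphs and their fibres *)

Definition direct_rel (X Y : finType) (e : rel X) (f : rel Y) : rel (X * Y) :=
  fun p q => e p.1 q.1 && f p.2 q.2.

Lemma card_fibres1 (X Y : finType) (F : X -> {set Y}) :
  #|[set p : X * Y | p.2 \in F p.1]| = \sum_u #|F u|.
Proof.
rewrite -sum1_card (eq_bigl _ _ (fun p => in_set _ p)).
rewrite -(pair_big_dep predT (fun u h => h \in F u) (fun _ _ => 1)) /=.
by apply: eq_bigr => u _; rewrite sum1_card.
Qed.

Lemma card_fibres2 (X Y : finType) (F : Y -> {set X}) :
  #|[set p : X * Y | p.1 \in F p.2]| = \sum_h #|F h|.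
Proof.
have inj : injective (fun p : Y * X => (p.2, p.1)) by move=> [a b] [c d] [-> ->].
rewrite -card_fibres1 -(card_imset _ inj).
apply: eq_card => -[x y]; rewrite !inE; apply/idP/imsetP => /=.
  by move=> xF; exists (y, x); rewrite ?inE.
by move=> [[y' x']]; rewrite inE /= => ? [-> ->].
Qed.

Lemma card_preim_fst (X Y : finType) (I : {set X}) :
  #|[set p : X * Y | p.1 \in I]| = #|I| * #|Y|.
Proof. by rewrite (card_fibres2 (fun=> I)) sum_nat_const mulnC. Qed.

Lemma card_preim_snd (X Y : finType) (J : {set Y}) :
  #|[set p : X * Y | p.2 \in J]| = #|X| * #|J|.
Proof. by rewrite (card_fibres1 (fun=> J)) sum_nat_const. Qed.

(** For adjacent h and k, a vertex of F h has no neighbour in the dominating set F k, so it lies in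
    F k. Symmetry gives equality along edges, and connectedness spreads it. *)
Lemma independent_fibres_const (X Y : finType) (e : rel X) (f : rel Y)
    (F : Y -> {set X}) :
  symmetric f -> connected_graph f ->
  (forall h k u v, f h k -> u \in F h -> v \in F k -> ~~ e u v) ->
  (forall h, cnbhd e (F h) = setT) ->
  forall h k, F h = F k.
Proof.
move=> symf conn cross dom.
have sub h k : f h k -> F h \subset F k.
  move=> fhk; apply/subsetP => u uh.
  have : u \in cnbhd e (F k) by rewrite dom inE.
  move=> /setUP[/nbhdP[v vk evu]|//].
  by have := cross k h v u; rewrite symf fhk vk uh evu => /(_ isT isT isT).
move=> h k; have /connectP[p + ->] := conn h k.
elim: p h => //= h' p IH h /andP[fhh' /IH <-].
by apply/eqP; rewrite eqEsubset !sub // symf.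
Qed.

(* The key device: split each fibre S_u of an independent set S of the product
   into its isolated vertices [isolated u], which form an independent set of Y,
   and the rest; the pairs of the second kind have independent fibres
   [attached h] over Y, and the closed neighbourhoods of the two families of
   fibres occupy disjoint parts of the product. *)
Section FibreDecomposition.
Variables (X Y : finType) (e : rel X) (f : rel Y) (S : {set X * Y}).
Hypothesis symf : symmetric f.
Hypothesis iS : independent (direct_rel e f) S.

Definition isolated (u : X) : {set Y} :=
  [set h | ((u, h) \in S) && [forall k, ((u, k) \in S) ==> ~~ f h k]].

Definition attached (h : Y) : {set X} :=
  [set u | ((u, h) \in S) && [exists k, ((u, k) \in S) && f h k]].

Let crossS u h v k : (u, h) \in S -> (v, k) \in S -> e u v -> f h k -> False.
Proof.
by move=> S1 S2 e1 f1; have /independentP/(_ _ _ S1 S2) := iS; rewrite /direct_rel /= e1 f1.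
Qed.

Lemma isolatedP u h : reflect ((u, h) \in S /\ forall k, (u, k) \in S -> ~~ f h k)
  (h \in isolated u).
Proof.
rewrite inE; apply: (iffP andP) => -[-> H]; split=> //.
  by move=> k; apply/implyP/(forallP H).
by apply/forallP => k; apply/implyP/H.
Qed.

Lemma attachedP u h : reflect ((u, h) \in S /\ exists2 k, (u, k) \in S & f h k)
  (u \in attached h).
Proof.
by rewrite inE; apply: (iffP andP) => -[-> H]; split=> //; apply/exists_inP.
Qed.

Lemma mem_isolated_attached u h :
  ((u, h) \in S) = (h \in isolated u) || (u \in attached h).
Proof.
apply/idP/orP => [uhS|[/isolatedP[]//|/attachedP[]//]].
case: (boolP [exists k, ((u, k) \in S) && f h k]) => [|/exists_inPn H].
  by move=> /exists_inP ?; right; apply/attachedP.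
by left; apply/isolatedP; split.
Qed.

Lemma isolated_independent u : independent f (isolated u).
Proof.
by apply/independentP => h k /isolatedP[_ H] /isolatedP[kS _]; apply: H.
Qed.

(** The witness k of attachment turns an edge uv into an edge between (u, k) and (v, h), both in
    S. *)
Lemma attached_free u v h : u \in attached h -> (v, h) \in S -> e u v -> False.
Proof.
move=> /attachedP[uhS [k ukS fhk]] vhS euv.
by apply: (crossS ukS vhS euv); rewrite symf.
Qed.

Lemma attached_independent h : independent e (attached h).
Proof.
apply/independentP => u v uh /attachedP[vh _]; apply/negP.
exact: attached_free uh vh.
Qed.

(** A common pair (u, h) would yield either two adjacent vertices of S or a neighbour, within the
    fibre over u, of an isolated vertex. *)
Lemma cnbhd_disjoint u h :
  h \in cnbhd f (isolated u) -> u \in cnbhd e (attached h) -> False.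
Proof.
move=> /setUP[/nbhdP[k ku fkh]|hu] /setUP[/nbhdP[v vh evu]|uh].
- have [ukS _] := isolatedP _ _ ku; have [vhS _] := attachedP _ _ vh.
  by apply: (crossS vhS ukS evu); rewrite symf.
- have [ukS H] := isolatedP _ _ ku; have [uhS _] := attachedP _ _ uh.
  by have := H _ uhS; rewrite fkh.
- by have [uhS _] := isolatedP _ _ hu; apply: (attached_free vh uhS).
- have [_ H] := isolatedP _ _ hu; have [_ [k /H/negP]] := attachedP _ _ uh.
  by [].
Qed.

Lemma card_isolated_attached :
  #|S| = \sum_u #|isolated u| + \sum_h #|attached h|.
Proof.
rewrite -card_fibres1 -card_fibres2 -cardsUI.
rewrite (_ : _ :&: _ = set0) ?cards0 ?addn0.
  by apply: eq_card => -[u h]; rewrite mem_isolated_attached !inE.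
apply/setP => -[u h]; rewrite !inE /=.
apply/negP => /andP[/andP[_ /forallP H] /andP[_ /exists_inP[k ukS fhk]]].
by have := H k; rewrite ukS fhk.
Qed.

Lemma card_cnbhd_tiles :
  (\sum_u #|cnbhd f (isolated u)| + \sum_h #|cnbhd e (attached h)|
    <= #|X| * #|Y| ?= iff
      [forall u, forall h, (h \in cnbhd f (isolated u))
                           || (u \in cnbhd e (attached h))])%N.
Proof.
rewrite -card_fibres1 -(@card_fibres2 X Y (fun h => cnbhd e (attached h))) -cardsUI.
set A := [set p | _]; set B := [set p | _].
have -> : A :&: B = set0.
  apply/setP => -[u h]; rewrite in_set0 in_setI; apply/negP => /andP[].
  by rewrite /A /B (in_set (fun p : X * Y => p.2 \in _)) (in_set (fun p : X * Y => p.1 \in _));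
    apply: cnbhd_disjoint.
rewrite cards0 addn0 -card_prod -cardsT.
have := subset_leqif_card (subsetT (A :|: B)); congr (leqif _ _ _).
rewrite subTset; apply/eqP/'forall_forallP => [H u h|H].
  by have : (u, h) \in A :|: B by [rewrite H inE]; rewrite !inE.
by apply/setP => -[u h]; have := H u h; rewrite !inE.
Qed.

Variable r : rat.
Hypothesis boundX : forall A : {set X}, independent e A ->
  (#|A|%:R <= r * #|cnbhd e A|%:R)%R.
Hypothesis boundY : forall A : {set Y}, independent f A ->
  (#|A|%:R <= r * #|cnbhd f A|%:R)%R.
Hypothesis r_gt0 : (0 < r)%R.

Local Open Scope ring_scope.

Let slackX h : rat := r * #|cnbhd e (attached h)|%:R - #|attached h|%:R.
Let slackY u : rat := r * #|cnbhd f (isolated u)|%:R - #|isolated u|%:R.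
Let gap : rat := #|X|%:R * #|Y|%:R
  - (\sum_u #|cnbhd f (isolated u)| + \sum_h #|cnbhd e (attached h)|)%N%:R.

Let slackX_ge0 h : 0 <= slackX h.
Proof. by rewrite subr_ge0 boundX // attached_independent. Qed.
Let slackY_ge0 u : 0 <= slackY u.
Proof. by rewrite subr_ge0 boundY // isolated_independent. Qed.
Let gap_ge0 : 0 <= gap.
Proof. by rewrite subr_ge0 -natrM ler_nat card_cnbhd_tiles. Qed.

(** The defect of S splits into nonnegative terms: r times the area left uncovered by the tiles, and
    the slack of every fibre in its ratio bound. A zero defect makes each of them vanish. *)
Let slack_total :
  r * (#|X|%:R * #|Y|%:R) - #|S|%:R = r * gap + (\sum_u slackY u + \sum_h slackX h).
Proof.
rewrite card_isolated_attached !sumrB -!mulr_sumr /gap !natrD !natr_sum; ring.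
Qed.

Lemma card_independent_direct : #|S|%:R <= r * (#|X|%:R * #|Y|%:R).
Proof.
rewrite -subr_ge0 slack_total !addr_ge0 ?sumr_ge0 // mulr_ge0 // ltW //.
Qed.

Lemma card_independent_direct_eq : #|S|%:R = r * (#|X|%:R * #|Y|%:R) ->
  [/\ forall u, #|isolated u|%:R = r * #|cnbhd f (isolated u)|%:R,
      forall h, #|attached h|%:R = r * #|cnbhd e (attached h)|%:R
    & forall u h, (h \in cnbhd f (isolated u)) || (u \in cnbhd e (attached h))].
Proof.
move=> cS; have := slack_total; rewrite cS subrr => /esym/eqP.
rewrite paddr_eq0 ?addr_ge0 ?sumr_ge0 ?mulr_ge0 ?(ltW r_gt0) //.
rewrite paddr_eq0 ?sumr_ge0 // mulf_eq0 (gt_eqF r_gt0) /=.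
move=> /and3P[gap0 /eqP sY /eqP sX]; split.
- move=> u; apply/esym/subr0_eq; apply: (psumr_eq0P _ sY) => //.
- move=> h; apply/esym/subr0_eq; apply: (psumr_eq0P _ sX) => //.
- move: gap0; rewrite subr_eq0 -natrM eqr_nat eq_sym card_cnbhd_tiles.
  by move=> /'forall_forallP H u h; apply: H.
Qed.

End FibreDecomposition.

(** * Maximum independent sets in a product of two factors *)

Definition vt_graph (T : finType) (e : rel T) : Prop :=
  [/\ simple_graph e, vertex_transitive e & 0 < #|T|].

Section Normality.
Variables (X Y : finType) (e : rel X) (f : rel Y) (S : {set X * Y}).
Hypotheses (syme : symmetric e) (symf : symmetric f).
Hypothesis iS : independent (direct_rel e f) S.

(** Dominating attached fibres fill the whole product, so disjointness of the tiles leaves no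
    isolated vertex, and the attached fibres are all equal by connectedness. *)
Lemma attached_dominating_normal : 0 < #|Y| -> connected_graph f ->
  (forall h, cnbhd e (attached f S h) = setT) ->
  exists2 I, independent e I & S = [set p | p.1 \in I].
Proof.
move=> /card_gt0P[h0 _] conn dom; exists (attached f S h0).
  exact: attached_independent iS h0.
have cst := independent_fibres_const symf conn _ dom.
apply/setP => -[u h]; rewrite (mem_isolated_attached f) [RHS]in_set /= (cst _ h h0).
  case: (boolP (h \in isolated f S u)) => //= /(subsetP (sub_cnbhd f _)) hu.
  by case: (cnbhd_disjoint symf iS hu); rewrite dom inE.
move=> {}h k {}u v fhk /attachedP[uhS _] /attachedP[vkS _].
by have /independentP/(_ _ _ uhS vkS) := iS; rewrite /direct_rel /= fhk andbT.
Qed.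

Lemma isolated_dominating_normal : 0 < #|X| -> connected_graph e ->
  (forall u, cnbhd f (isolated f S u) = setT) ->
  exists2 J, independent f J & S = [set p | p.2 \in J].
Proof.
move=> /card_gt0P[u0 _] conn dom; exists (isolated f S u0).
  exact: isolated_independent.
have cst := independent_fibres_const syme conn _ dom.
apply/setP => -[u h]; rewrite (mem_isolated_attached f) [RHS]in_set /= (cst _ u u0).
  case: (boolP (u \in attached f S h)) => [|_]; last by rewrite orbF.
  move=> /(subsetP (sub_cnbhd e _)) uh.
  by case: (cnbhd_disjoint symf iS _ uh); rewrite dom inE.
move=> {}u v {}h k euv /isolatedP[uhS _] /isolatedP[vkS _].
by have /independentP/(_ _ _ uhS vkS) := iS; rewrite /direct_rel /= euv.
Qed.

End Normality.

(** Primitivity leaves only the size alpha for a nonempty tight set, and then r |T| = alpha = r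
    |N[A]|. *)
Lemma primitive_dichotomy (T : finType) (e : rel T) (A : {set T}) :
  vt_graph e -> IS_primitive e -> independent e A ->
  (#|A|%:R = indep_ratio e * #|cnbhd e A|%:R)%R ->
  A = set0 \/ cnbhd e A = setT.
Proof.
move=> [sg vt T0] prim iA cA.
have [->|A0] := eqVneq A set0; [by left|right].
have N0 : (#|cnbhd e A|%:R != 0 :> rat)%R.
  rewrite pnatr_eq0 -lt0n; apply: leq_trans (subset_leq_card (sub_cnbhd e A)).
  by rewrite card_gt0.
have cAa : #|A| = alpha e.
  apply/eqP; rewrite eqn_leq leq_alpha //= leqNgt; apply/negP => lt.
  by apply: prim; exists A; split=> //; rewrite cA mulfK.
move: cA; rewrite cAa indep_ratioE // => /(mulfI (lt0r_neq0 (indep_ratio_gt0 sg.2 T0))).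
move=> /eqP; rewrite eqr_nat => /eqP cT; apply/eqP.
by rewrite eqEcard subsetT cardsT cT leqnn.
Qed.

Section DirectProduct.
Variables (X Y : finType) (e : rel X) (f : rel Y).
Hypotheses (vte : vt_graph e) (vtf : vt_graph f).

Lemma direct_vt_graph : vt_graph (direct_rel e f).
Proof.
move: vte vtf => [[syme irre] te X0] [[symf irrf] tf Y0]; split.
- split=> [p q|p]; first by rewrite /direct_rel syme symf.
  by rewrite /direct_rel irre.
- move=> [x y] [x' y']; have [a [aa ax]] := te x x'; have [b [ab bx]] := tf y y'.
  have inj : injective (fun p : X * Y => (a p.1, b p.2)).
    by move=> [? ?] [? ?] [/perm_inj-> /perm_inj->].
  exists (perm inj); split=> [p q|]; rewrite !permE /direct_rel /= ?ax ?bx //.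
  by rewrite aa ab.
- by rewrite card_prod muln_gt0 X0.
Qed.

Lemma independent_fst (I : {set X}) : independent e I ->
  independent (direct_rel e f) [set p | p.1 \in I].
Proof.
move=> /independentP iI; apply/independentP => -[u h] [v k].
by rewrite !inE /= => uI vI; rewrite /direct_rel /= negb_and iI.
Qed.

Lemma independent_snd (J : {set Y}) : independent f J ->
  independent (direct_rel e f) [set p | p.2 \in J].
Proof.
move=> /independentP iI; apply/independentP => -[u h] [v k].
by rewrite !inE /= => uI vI; rewrite /direct_rel /= negb_and iI ?orbT.
Qed.

Hypothesis le_ratio : (indep_ratio f <= indep_ratio e)%R.
Local Open Scope ring_scope.

Let boundX (A : {set X}) : independent e A ->
  #|A|%:R <= indep_ratio e * #|cnbhd e A|%:R.
Proof. by have [? ? ?] := vte; apply: card_cnbhd. Qed.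

Let boundY (A : {set Y}) : independent f A ->
  #|A|%:R <= indep_ratio e * #|cnbhd f A|%:R.
Proof.
(* The bound for Y is relaxed to the larger ratio of X, so that one constant serves both factors. *)
have [? ? ?] := vtf; move=> /(card_cnbhd _) H; apply: le_trans (H _ _ _) _ => //.
by rewrite ler_wpM2r.
Qed.

Let symf : symmetric f. Proof. by case: vtf => -[]. Qed.
Let syme : symmetric e. Proof. by case: vte => -[]. Qed.
Let X_gt0 : (0 < #|X|)%N. Proof. by case: vte. Qed.
Let Y_gt0 : (0 < #|Y|)%N. Proof. by case: vtf. Qed.
Let r_gt0 : 0 < indep_ratio e.
Proof. by have [[_ ?] _ ?] := vte; apply: indep_ratio_gt0. Qed.

(** The fibre decomposition bounds the ratio from above; the preimage of a maximum independent set
    of X attains it. *)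
Lemma indep_ratio_direct : indep_ratio (direct_rel e f) = indep_ratio e.
Proof.
have XY0 : 0 < #|X|%:R * #|Y|%:R :> rat by rewrite mulr_gt0 ?ltr0n.
rewrite {1}/indep_ratio card_prod natrM.
apply: (mulIf (lt0r_neq0 XY0)); rewrite divfK ?lt0r_neq0 //.
apply/eqP; rewrite eq_le; apply/andP; split.
  have [S /andP[iS /eqP <-]] := alpha_witness (direct_rel e f).
  exact: (card_independent_direct symf iS boundX boundY r_gt0).
have [M /andP[iM /eqP cM]] := alpha_witness e.
rewrite mulrA -indep_ratioE // -natrM ler_nat -cM -card_preim_fst.
exact/leq_alpha/independent_fst.
Qed.

Lemma max_independent_fst (I : {set X}) : independent e I ->
  max_independent (direct_rel e f) [set p | p.1 \in I] = max_independent e I.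
Proof.
move=> iI; have [_ _ XY0] := direct_vt_graph.
rewrite !max_independent_card ?independent_fst // indep_ratio_direct.
rewrite card_preim_fst card_prod !natrM mulrA (inj_eq (mulIf _)) //.
by rewrite pnatr_eq0 -lt0n.
Qed.

Lemma max_independent_snd (J : {set Y}) : indep_ratio f = indep_ratio e ->
  independent f J ->
  max_independent (direct_rel e f) [set p | p.2 \in J] = max_independent f J.
Proof.
move=> eqr iJ; have [_ _ XY0] := direct_vt_graph.
rewrite !max_independent_card ?independent_snd // indep_ratio_direct eqr.
rewrite card_preim_snd card_prod !natrM mulrCA (inj_eq (mulfI _)) //.
by rewrite pnatr_eq0 -lt0n.
Qed.

Let MIS_tight (S : {set X * Y}) : max_independent (direct_rel e f) S ->
  [/\ forall u, #|isolated f S u|%:R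
                  = indep_ratio e * #|cnbhd f (isolated f S u)|%:R,
      forall h, #|attached f S h|%:R
                  = indep_ratio e * #|cnbhd e (attached f S h)|%:R
    & forall u h, (h \in cnbhd f (isolated f S u))
                  || (u \in cnbhd e (attached f S h))].
Proof.
move=> mS; have /andP[iS _] := mS; have [_ _ XY0] := direct_vt_graph.
apply: (card_independent_direct_eq symf iS boundX boundY r_gt0).
move: mS; rewrite max_independent_card // indep_ratio_direct => /eqP ->.
by rewrite card_prod natrM.
Qed.

(** A nonempty isolated part would attain the ratio of X, whereas Y allows only a smaller one. So
    the attached tiles cover everything. *)
Lemma MIS_direct_lt (S : {set X * Y}) : connected_graph f ->
  indep_ratio f < indep_ratio e -> max_independent (direct_rel e f) S ->
  exists2 I, max_independent e I & S = [set p | p.1 \in I].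
Proof.
move=> conn lt mS; have /andP[iS _] := mS; have [tY _ tiles] := MIS_tight mS.
have iso0 u : cnbhd f (isolated f S u) = set0.
  have [? ? ?] := vtf; apply/eqP; rewrite -cards_eq0 -leqn0 leqNgt; apply/negP => N0.
  have : #|isolated f S u|%:R <= indep_ratio f * #|cnbhd f (isolated f S u)|%:R.
    by rewrite card_cnbhd // isolated_independent.
  by rewrite tY leNgt ltr_pM2r ?lt // ltr0n.
have [|||I iI eS] := @attached_dominating_normal _ _ e f S symf iS => //.
  by move=> h; apply/setP => u; have := tiles u h; rewrite iso0 in_set0 in_setT.
by exists I => //; rewrite -max_independent_fst // -eS.
Qed.

Lemma MIS_direct_eq (S : {set X * Y}) : connected_graph e -> connected_graph f ->
  IS_primitive e -> IS_primitive f -> indep_ratio f = indep_ratio e ->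
  max_independent (direct_rel e f) S ->
  (exists2 I, max_independent e I & S = [set p | p.1 \in I]) \/
  (exists2 J, max_independent f J & S = [set p | p.2 \in J]).
Proof.
move=> conne connf pe pf eqr mS; have /andP[iS _] := mS.
have [tY tX tiles] := MIS_tight mS.
have dX h := primitive_dichotomy vte pe (attached_independent symf iS h) (tX h).
rewrite -eqr in tY.
have dY u := primitive_dichotomy vtf pf (isolated_independent f S u) (tY u).
have cn0 (T : finType) (e' : rel T) : cnbhd e' set0 = set0.
  by apply/setP => x; rewrite !inE orbF; apply/exists_inP => -[y]; rewrite inE.
have /card_gt0P[u0 _] := X_gt0; have /card_gt0P[h0 _] := Y_gt0.
(* One isolated part decides the direction. If it is empty, every attached tile must contain [u0]
   and so is dominating. If it dominates, an empty isolated part elsewhere would force a dominating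
   attached fibre, overlapping the tile at [u0]. *)
case: (dY u0) => [iso0|dom0].
  left; have [|||I iI eS] := @attached_dominating_normal _ _ e f S symf iS => //.
    move=> h; case: (dX h) => // att0; have := tiles u0 h.
    by rewrite iso0 att0 !cn0 !inE.
  by exists I => //; rewrite -max_independent_fst // -eS.
right; have [|||J iJ eS] := @isolated_dominating_normal _ _ e f S syme symf iS => //.
  move=> u; case: (dY u) => // iso0; have := tiles u h0; rewrite iso0 cn0 inE /=.
  case: (dX h0) => [->|domX]; first by rewrite cn0 inE.
  by case: (@cnbhd_disjoint _ _ e f S symf iS u0 h0); rewrite ?dom0 ?domX inE.
by exists J => //; rewrite -max_independent_snd // -eS.
Qed.

End DirectProduct.

(** * Single vertex-transitive graphs: connectedness and ratio one half *)

Lemma imprimitive_card (T : finType) (e : rel T) (A : {set T}) :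
  imprimitive e A -> (#|A|%:R = indep_ratio e * #|cnbhd e A|%:R)%R.
Proof.
move=> [A0 _ _ <-]; rewrite divfK // pnatr_eq0 -lt0n.
by apply: leq_trans (subset_leq_card (sub_cnbhd e A)); rewrite card_gt0.
Qed.

Section VertexTransitive.
Variables (T : finType) (e : rel T).
Hypothesis vte : vt_graph e.

Let syme : symmetric e. Proof. by case: vte => -[]. Qed.
Let vt : vertex_transitive e. Proof. by case: vte. Qed.
Let T_gt0 : 0 < #|T|. Proof. by case: vte. Qed.
Let r_gt0 : (0 < indep_ratio e)%R.
Proof. by have [[_ ?] _ ?] := vte; apply: indep_ratio_gt0. Qed.

Lemma alpha_lt_card : (indep_ratio e < 1)%R -> alpha e < #|T|.
Proof.
move=> r1; rewrite -(ltr_nat rat) (indep_ratioE e T_gt0).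
by rewrite gtr_pMl // ltr0n.
Qed.

Lemma vt_nonisolated x : (indep_ratio e < 1)%R -> exists y, e x y.
Proof.
move=> /alpha_lt_card lt.
case: (boolP [exists y, e x y]) => [/existsP //|/existsPn no].
suff /leq_alpha : independent e setT by rewrite cardsT leqNgt lt.
apply/independentP => u v _ _; have [g [ag gu]] := vt u x.
by rewrite -ag gu.
Qed.

(** An automorphism carrying x to a vertex outside M pulls M back to a set that misses x. *)
Lemma MIS_avoiding x : (indep_ratio e < 1)%R ->
  exists2 M, max_independent e M & x \notin M.
Proof.
move=> /alpha_lt_card lt; have [M /andP[iM /eqP cM]] := alpha_witness e.
have [y yM] : exists y, y \notin M.
  apply/existsP; rewrite -negb_forall; apply: contraL lt => /forallP all.
  rewrite -cM -leqNgt -cardsT; apply/subset_leq_card/subsetP => y _; exact: all.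
have [g [ag gx]] := vt x y.
exists (g @^-1: M); last by rewrite inE gx.
have gA : g \in graph_auts e by apply/graph_autsP.
rewrite /max_independent (preim_independent gA iM) /=.
by rewrite (card_preimset _ (@perm_inj _ g)) cM.
Qed.

(** A largest independent subset A of the component K of x satisfies r |K| <= |A| by averaging, and
    |A| <= r |N[A]| <= r |K| because N[A] lies in K. So A is tight and nonempty, and primitivity
    makes N[A], hence K, the whole graph. *)
Lemma primitive_connected : IS_primitive e -> connected_graph e.
Proof.
move=> prim x y; pose K := [set z | connect e x z].
have iK0 : independent e set0 && (set0 \subset K).
  by rewrite sub0set andbT; apply/independentP => u v; rewrite inE.
case: (@arg_maxnP _ set0 (fun A => independent e A && (A \subset K))
  (fun A => #|A|) iK0) => A /andP[iA sAK] maxA.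
have [M /andP[iM /eqP cM]] := alpha_witness e.
have lb : #|M| * #|K| <= #|A| * #|T|.
  apply: (average_le vt) => g ag; apply: maxA; rewrite subsetIr andbT.
  by apply: sub_independent (preim_independent ag iM); apply: subsetIl.
have sNK : cnbhd e A \subset K.
  rewrite subUset sAK andbT; apply/subsetP => z /nbhdP[a /(subsetP sAK)].
  by rewrite !inE => xa eaz; apply: connect_trans xa (connect1 eaz).
have lbr : (indep_ratio e * #|K|%:R <= #|A|%:R)%R.
  move: lb; rewrite cM -(ler_nat rat) !natrM (indep_ratioE e T_gt0) mulrAC.
  by rewrite ler_pM2r // ltr0n.
have [sg _ _] := vte; have ub := card_cnbhd sg vt T_gt0 iA.
have NK : (indep_ratio e * #|cnbhd e A|%:R <= indep_ratio e * #|K|%:R)%R.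
  by rewrite ler_pM2l // ler_nat subset_leq_card.
have [A0|NT] := primitive_dichotomy vte prim iA ltac:(lra).
  suff : (0 < #|A|%:R :> rat)%R by rewrite A0 cards0.
  apply: lt_le_trans lbr; rewrite mulr_gt0 // ltr0n; apply/card_gt0P.
  by exists x; rewrite inE connect0.
by have := subsetP sNK y; rewrite NT !inE => /(_ isT).
Qed.

Lemma vt_regular x y : #|[set z | e x z]| = #|[set z | e y z]|.
Proof.
suff le u v : #|[set z | e u z]| <= #|[set z | e v z]|.
  by apply/eqP; rewrite eqn_leq !le.
have [g [ag gu]] := vt u v; rewrite -(card_imset _ (@perm_inj _ g)).
apply/subset_leq_card/subsetP => _ /imsetP[z + ->].
by rewrite !inE -gu ag.
Qed.

(* Counting the edges between A and N(A) from both ends. *)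
Lemma nbhd_tight (A : {set T}) b c :
  #|nbhd e A| <= #|A| -> b \in nbhd e A -> e b c -> c \in A.
Proof.
move=> le bN ebc; pose d := #|[set z | e b z]|.
have cE x : #|[set z | e x z]| = d by apply: vt_regular.
have deg : d * #|A| = \sum_(y in nbhd e A) #|[set a in A | e a y]|.
  rewrite mulnC -sum_nat_const.
  rewrite (eq_bigr (fun a => \sum_(y in nbhd e A) e a y)) => [|a aA].
    rewrite exchange_big /=; apply: eq_bigr => y _.
    by rewrite -sum1dep_card big_mkcondr.
  rewrite -(cE a) -sum1dep_card -big_mkcondr; apply: eq_bigl => y.
  by case: (boolP (e a y)) => [eay|_]; rewrite ?andbF // andbT; apply/esym/nbhdP; exists a.
have sub y : y \in nbhd e A -> #|[set a in A | e a y]| <= d.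
  move=> _; rewrite -(cE y); apply/subset_leq_card/subsetP => a.
  by rewrite !inE syme => /andP[].
have [leS eqS] := leqif_sum (fun y yN => leqif_eq (sub y yN)).
have /forall_inP/(_ b bN)/eqP eqb :
  [forall (y | y \in nbhd e A), #|[set a in A | e a y]| == d].
  rewrite -eqS eqn_leq leS sum_nat_const /= -deg [d * _]mulnC.
  by rewrite leq_mul2r le orbT.
have : [set a in A | e a b] == [set z | e b z].
  rewrite eqEcard eqb cE leqnn andbT; apply/subsetP => a.
  by rewrite !inE syme => /andP[].
by move=> /eqP/setP/(_ c); rewrite !inE ebc => /andP[].
Qed.

Lemma nbhd_indep_disjoint (A : {set T}) : independent e A ->
  #|cnbhd e A| = #|nbhd e A| + #|A|.
Proof.
move=> /independentP iA; rewrite cardsU (_ : _ :&: _ = set0) ?cards0 ?subn0 //.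
apply/setP => x; rewrite in_set0; apply/setIP => -[/nbhdP[a aA eax] xA].
by have := iA a x aA xA; rewrite eax.
Qed.

(** At ratio 1/2 a tight set has |N(A)| = |A|, so [nbhd_tight] makes N[A] closed under adjacency.
    Connectedness then gives N[A] = T, whence |A| = alpha. *)
Lemma half_primitive : connected_graph e -> (indep_ratio e = 1 / 2%:R)%R ->
  IS_primitive e.
Proof.
move=> conn half [A impA]; have cA := imprimitive_card impA.
case: impA => A0 iA ltA _.
have cN : #|nbhd e A| = #|A|.
  move: cA; rewrite half nbhd_indep_disjoint // natrD => cA; apply/eqP.
  by rewrite -(eqr_nat rat); apply/eqP; lra.
suff NT : cnbhd e A = setT.
  by move: ltA; rewrite -(ltr_nat rat) (indep_ratioE e T_gt0) cA NT cardsT ltxx.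
have closed x y : e x y -> x \in cnbhd e A -> y \in cnbhd e A.
  move=> exy /setUP[xN|xA]; apply/setUP; [right|left].
    by apply: nbhd_tight exy; rewrite ?cN.
  by apply/nbhdP; exists x.
have [a aA] := set0Pn _ A0.
apply/setP => y; rewrite in_setT; have /connectP[p + ->] := conn a y.
have : a \in cnbhd e A by apply: (subsetP (sub_cnbhd e A)).
by elim: p a {aA} => //= z p IH a aN /andP[eaz]; apply/IH/(closed a).
Qed.

(** The ratio bound forces N[M] = T and |N(M)| <= |M|, so a vertex outside M lies in N(M) and has
    all its neighbours in M. *)
Lemma half_bipartite (M : {set T}) : (indep_ratio e = 1 / 2%:R)%R ->
  max_independent e M -> independent e (~: M).
Proof.
move=> half mM; have /andP[iM /eqP cM] := mM.
move: mM; rewrite max_independent_card // half => /eqP cMh.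
have [sg _ _] := vte; have := card_cnbhd sg vt T_gt0 iM.
rewrite cMh half => leN; have NT : cnbhd e M = setT.
  apply/eqP; rewrite eqEcard subsetT cardsT -(ler_nat rat); lra.
have cN : #|nbhd e M| <= #|M|.
  have := nbhd_indep_disjoint iM; rewrite NT cardsT => cT.
  by move: cMh; rewrite cT natrD -(ler_nat rat) => H; lra.
apply/independentP => b c; rewrite !in_setC => bM cM'; apply/negP => ebc.
move/negP: cM'; apply; apply: nbhd_tight ebc => //.
by have : b \in cnbhd e M; [rewrite NT inE|rewrite in_setU (negPf bM) orbF].
Qed.

End VertexTransitive.

(** * Primitivity of products below ratio one half *)

Lemma cnbhd_preim_fst (X Y : finType) (e : rel X) (f : rel Y) (B : {set X}) :
  symmetric f -> (forall h, exists k, f h k) ->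
  cnbhd (direct_rel e f) [set p | p.1 \in B] = [set p | p.1 \in cnbhd e B].
Proof.
move=> symf nbrf; apply/setP => -[u h]; rewrite [RHS]in_set /=.
apply/setUP/setUP.
  case=> [/nbhdP[[v k]]|]; rewrite inE /=; last by right.
  by move=> vB /andP[/= evu _]; left; apply/nbhdP; exists v.
case=> [/nbhdP[v vB evu]|uB]; last by right; rewrite inE.
have [k fhk] := nbrf h; left; apply/nbhdP; exists (v, k); first by rewrite inE.
by rewrite /direct_rel /= evu symf.
Qed.

Section PrimitiveProduct.
Variables (X Y : finType) (e : rel X) (f : rel Y).
Hypotheses (vte : vt_graph e) (vtf : vt_graph f).
Hypotheses (le_ratio : (indep_ratio f <= indep_ratio e)%R).
Hypotheses (lt_half : (indep_ratio e < 1 / 2%:R)%R).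
Hypothesis normal : forall S, max_independent (direct_rel e f) S ->
  (exists2 I, max_independent e I & S = [set p | p.1 \in I]) \/
  (exists2 J, max_independent f J & S = [set p | p.2 \in J]).

Let ltre1 : (indep_ratio e < 1)%R. Proof. by move: lt_half; lra. Qed.
Let ltrf1 : (indep_ratio f < 1)%R. Proof. by move: lt_half le_ratio; lra. Qed.

(** Below one half, two maximum independent sets have fewer than |X| vertices altogether. *)
Let MIS_no_cover (I1 I2 : {set X}) : max_independent e I1 ->
  max_independent e I2 -> exists2 u, u \notin I1 & u \notin I2.
Proof.
move=> /andP[_ /eqP c1] /andP[_ /eqP c2]; have [_ _ X0] := vte.
have lt : #|I1 :|: I2| < #|X|.
  rewrite cardsU c1 c2; apply: leq_ltn_trans (leq_subr _ _) _.
  rewrite -(ltr_nat rat) natrD (indep_ratioE e X0).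
  have : (0 < #|X|%:R :> rat)%R by rewrite ltr0n.
  move: lt_half; nra.
have [u uI] : exists u, u \notin I1 :|: I2.
  apply/existsP; rewrite -negb_forall; apply: contraL lt => /forallP all.
  by rewrite -leqNgt -cardsT; apply/subset_leq_card/subsetP => u _; exact: all.
by move: uI; rewrite in_setU negb_or => /andP[]; exists u.
Qed.

(* Exchanging an imprimitive set A into the maximum independent sets I x Y must
   again give preimages, which forces A to be a union of fibres of the first
   projection. *)
Lemma direct_primitive : IS_primitive e -> IS_primitive (direct_rel e f).
Proof.
move=> prim [A impA]; have cA := imprimitive_card impA.
case: impA => A0 iA ltA _; have [sgP vtP P0] := direct_vt_graph vte vtf.
have rP := indep_ratio_direct vte vtf le_ratio.
pose N := cnbhd (direct_rel e f) A.
pose exch (I : {set X}) := A :|: ([set p : X * Y | p.1 \in I] :\: N).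
have mexch I : max_independent e I -> max_independent (direct_rel e f) (exch I).
  move=> mI; apply: (max_independent_exchange sgP vtP P0) => //.
  by rewrite max_independent_fst //; case/andP: mI.
have exchE (I : {set X}) u h : u \notin I -> ((u, h) \in exch I) = ((u, h) \in A).
  by move=> uI; rewrite /exch in_setU in_setD !inE (negPf uI) andbF orbF.
(* Suppose [exch I] is X x J. For [I2] avoiding u, the fibre over some v outside both I and [I2] is
   J, neither empty nor full, so [exch I2] is again X x J. Hence every fibre of A is J, and A =
   [exch I] would be maximum. *)
have snd_false I J : max_independent e I -> max_independent f J ->
    exch I = [set p | p.2 \in J] -> False.
  move=> mI mJ eI; have eA u h : ((u, h) \in A) = (h \in J).
    have [I2 mI2 uI2] := MIS_avoiding vte u ltre1.
    have [v vI vI2] := MIS_no_cover mI mI2.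
    have vJ k : ((v, k) \in exch I2) = (k \in J).
      by rewrite exchE // -(exchE I) // eI inE.
    rewrite -(exchE I2) //; case: (normal (mexch _ mI2)) => [[I3 _ e3]|[J3 _ e3]].
      have const k : (k \in J) = (v \in I3) by rewrite -vJ e3 inE.
      have [_ _ Y0] := vtf; have := alpha_lt_card vtf ltrf1.
      have [[_ irrf] _ _] := vtf; have := alpha_gt0 irrf Y0.
      move: mJ => /andP[_ /eqP <-].
      have [vI3|vI3] := boolP (v \in I3).
        suff -> : J = setT by rewrite cardsT ltnn.
        by apply/setP => k; rewrite const vI3 inE.
      suff -> : J = set0 by rewrite cards0.
      by apply/setP => k; rewrite const (negPf vI3) inE.
    by rewrite e3 !inE /= -vJ e3 inE.
  suff eqA : A = exch I.
    by have /andP[_ /eqP cm] := mexch _ mI; move: ltA; rewrite -cm -eqA ltnn.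
  by rewrite eI; apply/setP => -[u h]; rewrite eA inE.
(* Over a vertex outside I the sets [exch I] and A agree, and [exch I] is now known to be a preimage
   from X. *)
have full u h k : ((u, h) \in A) = ((u, k) \in A).
  have [I mI uI] := MIS_avoiding vte u ltre1.
  rewrite -!(exchE I) //; case: (normal (mexch _ mI)) => [[I' _ ->]|[J mJ eJ]].
    by rewrite !inE.
  by case: (snd_false _ _ mI mJ eJ).
pose B := [set u | [exists h, (u, h) \in A]].
have memB u h : ((u, h) \in A) = (u \in B).
  by rewrite inE; apply/idP/existsP => [uh|[k]]; [exists h|rewrite (full u h k)].
have nbrf h : exists k, f h k by apply: vt_nonisolated.
have [_ _ Y0] := vtf; have [h0 _] := card_gt0P Y0.
have symf : symmetric f by case: vtf => -[].
have eqA : A = [set p | p.1 \in B] by apply/setP => -[u h]; rewrite memB [RHS]in_set.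
have eqN : N = [set p | p.1 \in cnbhd e B] by rewrite /N eqA cnbhd_preim_fst.
have Yr : (#|Y|%:R != 0 :> rat)%R by rewrite pnatr_eq0 -lt0n.
(* A is B x Y, and its size, closed neighbourhood and bound alpha are those of B scaled by |Y|, so B
   is imprimitive in X. *)
apply: prim; exists B; split.
- have [[u h]] := set0Pn _ A0; rewrite memB => uB.
  by apply/set0Pn; exists u.
- apply/independentP => u v uB vB; have [k fhk] := nbrf h0.
  have /independentP/(_ (u, h0) (v, k)) := iA; rewrite !memB uB vB.
  by rewrite /direct_rel /= fhk andbT; apply.
- move: ltA; rewrite -!(ltr_nat rat) (indep_ratioE _ P0) rP eqA card_preim_fst.
  by rewrite card_prod !natrM mulrA -indep_ratioE ?ltr_pM2r ?ltr0n //; case: vte.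
- move: cA; rewrite -/N eqN {1}eqA !card_preim_fst rP !natrM mulrA => /(mulIf Yr) ->.
  rewrite mulfK // pnatr_eq0 -lt0n card_gt0; have [[u h]] := set0Pn _ A0.
  rewrite memB => uB; apply/set0Pn; exists u; exact: (subsetP (sub_cnbhd e B)).
Qed.

End PrimitiveProduct.

(** * Maximum independent sets that depend on several coordinates *)

Lemma max_independent_mixed (X Y : finType) (e : rel X) (f : rel Y)
    (A : {set X}) (M : {set Y}) :
  vt_graph e -> vt_graph f -> indep_ratio f = indep_ratio e ->
  (indep_ratio e < 1)%R -> imprimitive e A -> max_independent f M ->
  max_independent (direct_rel e f)
    [set p | (p.1 \in A) || (p.1 \notin cnbhd e A) && (p.2 \in M)].
Proof.
move=> vte vtf eqr r1 impA mM; have le_r : (indep_ratio f <= indep_ratio e)%R by rewrite eqr.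
have [sgP vtP P0] := direct_vt_graph vte vtf.
have [[symf _] _ _] := vtf.
have nbrf h : exists k, f h k by apply: vt_nonisolated => //; rewrite eqr.
have iA : independent e A by case: impA.
have cN := cnbhd_preim_fst e A symf nbrf.
(* The mixed set is the exchange of the tight set A x Y into the maximum independent set X x M. *)
have := @max_independent_exchange _ _ sgP vtP P0
  [set p : X * Y | p.1 \in A] [set p | p.2 \in M].
rewrite cN; set S := _ :|: _ => H.
suff -> : [set p | (p.1 \in A) || (p.1 \notin cnbhd e A) && (p.2 \in M)] = S.
  apply: H; first exact: independent_fst.
    by rewrite !card_preim_fst indep_ratio_direct // !natrM (imprimitive_card impA) mulrA.
  by rewrite max_independent_snd //; case/andP: mM.
apply/setP => p; rewrite /S in_setU in_setD.
by rewrite (in_set (fun p : X * Y => p.1 \in cnbhd e A)) [LHS]in_set 2!in_set.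
Qed.

Lemma half_flip (T : finType) (e : rel T) (M : {set T}) x y :
  vt_graph e -> (indep_ratio e = 1 / 2%:R)%R -> max_independent e M ->
  e x y -> (y \in M) = (x \notin M).
Proof.
move=> vte half mM exy; have /andP[/independentP iM _] := mM.
have /independentP iC := half_bipartite vte half mM.
have [xM|xM] := boolP (x \in M).
  by apply/negbTE/negP => yM; have := iM x y xM yM; rewrite exy.
apply: contraT => yM; have := iC x y.
by rewrite !in_setC xM yM exy => /(_ isT isT).
Qed.

Definition majority (a b c : bool) := [|| a && b, a && c | b && c].

(** An edge flips the colour class in all three coordinates, hence the majority. So Q and its
    complement are both independent, and as alpha is half the number of vertices both have exactly
    that size. *)
Lemma max_independent_majority (X Y Z : finType) (e : rel X) (f : rel Y) (g : rel Z)
    (M : {set X}) (N : {set Y}) (P : {set Z}) :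
  vt_graph e -> vt_graph f -> vt_graph g ->
  (indep_ratio e = 1 / 2%:R)%R -> (indep_ratio f = 1 / 2%:R)%R ->
  (indep_ratio g = 1 / 2%:R)%R ->
  max_independent e M -> max_independent f N -> max_independent g P ->
  max_independent (direct_rel (direct_rel e f) g)
    [set p | majority (p.1.1 \in M) (p.1.2 \in N) (p.2 \in P)].
Proof.
move=> vte vtf vtg re rf rg mM mN mP; set Q := [set p | _].
have vtef := direct_vt_graph vte vtf.
have ref : (indep_ratio (direct_rel e f) = 1 / 2%:R)%R.
  by rewrite indep_ratio_direct ?re ?rf.
have [_ _ P0] := direct_vt_graph vtef vtg.
have := indep_ratioE (direct_rel (direct_rel e f) g) P0.
rewrite indep_ratio_direct ?ref ?rg // => cP.
have flip p q : direct_rel (direct_rel e f) g p q -> (q \in Q) = (p \notin Q).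
  move=> /andP[/andP[e1 e2] e3]; rewrite !inE (half_flip vte re mM e1).
  rewrite (half_flip vtf rf mN e2) (half_flip vtg rg mP e3).
  by rewrite /majority; do 3 case: (_ \in _).
have iQ : independent (direct_rel (direct_rel e f) g) Q.
  by apply/independentP => p q pQ qQ; apply/negP => /flip; rewrite pQ qQ.
have iC : independent (direct_rel (direct_rel e f) g) (~: Q).
  apply/independentP => p q; rewrite !in_setC => pQ qQ; apply/negP => /flip.
  by rewrite pQ (negPf qQ).
rewrite /max_independent iQ /=; apply/eqP.
have leQ := leq_alpha iQ; have leC := leq_alpha iC.
have : #|Q| + #|~: Q| = (alpha (direct_rel (direct_rel e f) g)).*2.
  by apply/eqP; rewrite -(eqr_nat rat) -muln2 natrM natrD cP -(cardsC Q) natrD; lra.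
move: leQ leC; move: #|Q| #|~: Q| => a b; lia.
Qed.

(** * Iterated binary products and their comparison with the n-fold product *)

Lemma alpha_embedding (U V : finType) (e : rel U) (f : rel V) (phi : U -> V) :
  injective phi -> (forall x y, f (phi x) (phi y) = e x y) -> alpha e <= alpha f.
Proof.
move=> inj hom; have [M /andP[/independentP iM /eqP <-]] := alpha_witness e.
rewrite -(card_imset _ inj); apply/leq_alpha/independentP.
by move=> _ _ /imsetP[x xM ->] /imsetP[y yM ->]; rewrite hom iM.
Qed.

Section IteratedProduct.
Variables (n : nat) (T : 'I_n -> finType) (E : forall i, rel (T i)) (i0 : 'I_n).

(** Nested pairs make the two-factor results applicable. The innermost factor is [i0], whose ratio
    the others are compared with; the head of [s] is the outermost. *)
Fixpoint iter_prod (s : seq 'I_n) : finType :=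
  if s is j :: s' then (iter_prod s' * T j)%type else T i0.

Fixpoint iter_rel (s : seq 'I_n) : rel (iter_prod s) :=
  match s return rel (iter_prod s) with
  | [::] => @E i0
  | j :: s' => direct_rel (@iter_rel s') (@E j)
  end.

Fixpoint restrict (s : seq 'I_n) (x : prod_vertex T) : iter_prod s :=
  match s return iter_prod s with
  | [::] => x i0
  | j :: s' => (restrict s' x, x j)
  end.

Lemma restrict_rel s x y : iter_rel (restrict s x) (restrict s y)
  = all (fun i => @E i (x i) (y i)) (i0 :: s).
Proof.
elim: s => [|j s IH] /=; first by rewrite andbT.
by rewrite /direct_rel /= IH /= andbAC andbA.
Qed.

Lemma restrict_eq s x y :
  restrict s x = restrict s y -> {in i0 :: s, forall i, x i = y i}.
Proof.
elim: s => [|j s IH] /= => [eq i /[!inE] /eqP -> //|].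
move=> [/IH eq eqj] i; rewrite !inE => /or3P[/eqP->|/eqP->|si] //.
  by apply: eq; rewrite inE eqxx.
by apply: eq; rewrite inE si orbT.
Qed.

Lemma card_iter_prod s : #|iter_prod s| = \prod_(i <- i0 :: s) #|T i|.
Proof.
elim: s => [|j s IH] /=; first by rewrite big_seq1.
by rewrite card_prod IH !big_cons; ring.
Qed.

Section Cover.
Variable s : seq 'I_n.
Hypothesis cover : perm_eq (i0 :: s) (enum 'I_n).

Lemma restrict_inj : injective (restrict s).
Proof.
move=> x y /restrict_eq eq; apply/ffunP => i; apply: eq.
by rewrite (perm_mem cover) mem_enum.
Qed.

Lemma restrict_bij : bijective (restrict s).
Proof.
apply: inj_card_bij; first exact: restrict_inj.
rewrite card_iter_prod (perm_big _ cover) /= card_dep_ffun.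
by rewrite foldrE /image_mem [leqRHS]big_map.
Qed.

Lemma restrict_prod_rel x y :
  iter_rel (restrict s x) (restrict s y) = prod_rel E x y.
Proof.
rewrite restrict_rel (perm_all _ cover); apply/allP/forallP => H i.
  by apply: H; rewrite mem_enum.
by move=> _; apply: H.
Qed.

Lemma alpha_iter_rel : alpha (@iter_rel s) = alpha (prod_rel E).
Proof.
have [psi psiK Kpsi] := restrict_bij.
apply/eqP; rewrite eqn_leq; apply/andP; split.
  apply: (@alpha_embedding _ _ _ _ psi (can_inj Kpsi)) => x y.
  by rewrite -restrict_prod_rel !Kpsi.
exact: alpha_embedding restrict_inj restrict_prod_rel.
Qed.

Lemma max_independent_restrict (Q : {set iter_prod s}) :
  max_independent (@iter_rel s) Q ->
  max_independent (prod_rel E) [set x | restrict s x \in Q].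
Proof.
move=> /andP[/independentP iQ /eqP cQ]; apply/andP; split.
  by apply/independentP => x y; rewrite !inE -restrict_prod_rel; apply: iQ.
rewrite -alpha_iter_rel -cQ -(card_imset _ restrict_inj).
have [psi psiK Kpsi] := restrict_bij.
apply/eqP/eq_card => y; apply/imsetP/idP => [[x + ->]|yQ]; first by rewrite inE.
by exists (psi y); rewrite ?inE Kpsi.
Qed.

Lemma max_independent_image (S : {set prod_vertex T}) :
  max_independent (prod_rel E) S -> max_independent (@iter_rel s) (restrict s @: S).
Proof.
move=> /andP[/independentP iS /eqP cS]; apply/andP; split.
  apply/independentP => _ _ /imsetP[x xS ->] /imsetP[y yS ->].
  by rewrite restrict_prod_rel iS.
by rewrite alpha_iter_rel (card_imset _ restrict_inj) cS.
Qed.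

End Cover.

(** Phrased through [restrict] so that the deciding coordinate is read off the original vertex
    rather than located inside nested pairs. *)
Definition iter_normal s := forall S, max_independent (@iter_rel s) S ->
  exists i : 'I_n, exists I : {set T i},
    independent (@E i) I /\ forall x, (restrict s x \in S) = (x i \in I).

Lemma iter_normal_MIS_normal s :
  perm_eq (i0 :: s) (enum 'I_n) -> iter_normal s -> MIS_normal E.
Proof.
move=> cover norm S mS.
have [i [I [iI eI]]] := norm _ (max_independent_image cover mS).
exists i, I; split=> //; apply/setP => x.
by rewrite inE -eI (mem_imset _ _ (restrict_inj cover)).
Qed.

Hypothesis vtE : forall i, vt_graph (@E i).
Local Notation ratio i := (indep_ratio (@E i)).

Lemma iter_vt_graph s : vt_graph (@iter_rel s).
Proof. by elim: s => [|j s IH] //=; apply: direct_vt_graph. Qed.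

Lemma iter_ratio s : {in s, forall i, (ratio i <= ratio i0)%R} ->
  indep_ratio (@iter_rel s) = ratio i0.
Proof.
elim: s => [|j s IH] //= le.
have IH' : indep_ratio (@iter_rel s) = ratio i0.
  by apply: IH => i si; apply: le; rewrite inE si orbT.
rewrite indep_ratio_direct ?IH' //; first exact: iter_vt_graph.
by apply: le; rewrite inE eqxx.
Qed.

(** Pulling back along the first projection keeps a set maximum, since each added factor has ratio
    at most that of [i0]. *)
Lemma max_independent_lift s s' (Q : {set iter_prod s}) :
  {in s' ++ s, forall i, (ratio i <= ratio i0)%R} ->
  max_independent (@iter_rel s) Q ->
  exists2 Q' : {set iter_prod (s' ++ s)}, max_independent (@iter_rel (s' ++ s)) Q'
    & forall x, (restrict (s' ++ s) x \in Q') = (restrict s x \in Q).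
Proof.
elim: s' => [|j s' IH] /= le mQ; first by exists Q.
have le' : {in s' ++ s, forall i, (ratio i <= ratio i0)%R}.
  by move=> i si; apply: le; rewrite inE si orbT.
have [Q' mQ' eQ] := IH le' mQ.
exists [set p | p.1 \in Q'] => [|x]; last by rewrite inE eQ.
rewrite max_independent_fst //; first exact: iter_vt_graph.
  by rewrite iter_ratio // le // inE eqxx.
by case/andP: mQ'.
Qed.

Lemma iter_normal0 : iter_normal [::].
Proof. by move=> S /andP[iS _]; exists i0, S. Qed.

Lemma iter_normal_lt s s' : iter_normal s ->
  (forall i, connected_graph (@E i)) ->
  {in s, forall i, (ratio i <= ratio i0)%R} ->
  {in s', forall i, (ratio i < ratio i0)%R} -> iter_normal (s' ++ s).
Proof.
move=> norm conn le; elim: s' => [|j s' IH] //= lt S mS.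
have lt' : {in s', forall i, (ratio i < ratio i0)%R}.
  by move=> i si; apply: lt; rewrite inE si orbT.
have ltj : (ratio j < ratio i0)%R by apply: lt; rewrite inE eqxx.
have req : indep_ratio (@iter_rel (s' ++ s)) = ratio i0.
  by apply: iter_ratio => i; rewrite mem_cat => /orP[/lt'/ltW|/le].
have [|||I mI eS] := MIS_direct_lt (iter_vt_graph (s' ++ s)) (vtE j) _ _ _ mS.
- by rewrite req ltW.
- exact: conn.
- by rewrite req.
have [i [J [iJ eJ]]] := IH lt' _ mI.
by exists i, J; split=> // x; rewrite eS inE /= eJ.
Qed.

(** The induction step for equal ratios. Primitivity of the partial product is carried along because
    it supplies both the connectedness and the primitivity that the two-factor result asks for. *)
Lemma iter_normal_eq s j :
  {in s, forall i, (ratio i <= ratio i0)%R} -> ratio j = ratio i0 ->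
  iter_normal s -> connected_graph (@E j) ->
  IS_primitive (@iter_rel s) -> IS_primitive (@E j) ->
  iter_normal (j :: s) /\
  ((ratio i0 < 1 / 2%:R)%R -> IS_primitive (@iter_rel (j :: s))).
Proof.
move=> le rj norm conn ps pj; have req := iter_ratio le.
have rle : (ratio j <= indep_ratio (@iter_rel s))%R by rewrite req rj.
have alt S := MIS_direct_eq (iter_vt_graph s) (vtE j) rle
  (primitive_connected (iter_vt_graph s) ps) conn ps pj (S:=S) (etrans rj (esym req)).
split=> [S /alt[[I mI eS]|[J /andP[iJ _] eS]]|half].
- by have [i [J [iJ eJ]]] := norm _ mI; exists i, J; split=> // x; rewrite eS inE /= eJ.
- by exists j, J; split=> // x; rewrite eS inE.
- by apply: direct_primitive => //; rewrite ?req //; apply: iter_vt_graph.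
Qed.

Lemma iter_normal_primitive s :
  (forall i, connected_graph (@E i)) -> (ratio i0 < 1 / 2%:R)%R ->
  {in i0 :: s, forall i, ratio i = ratio i0 /\ IS_primitive (@E i)} ->
  iter_normal s /\ IS_primitive (@iter_rel s).
Proof.
move=> conn half; elim: s => [|j s IH] H.
  by split; [exact: iter_normal0 | apply: (H i0 _).2; rewrite inE].
have [|norm prim] := IH.
  by move=> i; rewrite inE => /orP[/eqP->|si]; apply: H; rewrite !inE ?eqxx ?si ?orbT.
have [rj pj] : ratio j = ratio i0 /\ IS_primitive (@E j).
  by apply: H; rewrite !inE eqxx orbT.
have le : {in s, forall i, (ratio i <= ratio i0)%R}.
  by move=> i si; rewrite (H i _).1 // !inE si !orbT.
by have [? /(_ half)] := iter_normal_eq le rj norm (conn j) prim pj.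
Qed.

End IteratedProduct.

(** * Failure of normality detected by changing single coordinates *)

Section Coordinates.
Variables (n : nat) (T : 'I_n -> finType) (E : forall i, rel (T i)).

Definition update (x : prod_vertex T) i (a : T i) : prod_vertex T :=
  [ffun k => dfwith x a k].

Lemma update_in x i (a : T i) : update x a i = a.
Proof. by rewrite ffunE dfwith_in. Qed.

Lemma update_out x i (a : T i) k : i != k -> update x a k = x k.
Proof. by move=> ik; rewrite ffunE dfwith_out. Qed.

(** Membership in a preimage from factor k changes only with coordinate k, which cannot be both i
    and j. *)
Lemma two_coordinates_not_normal (S : {set prod_vertex T}) i j x y
    (a : T i) (b : T j) :
  max_independent (prod_rel E) S -> i != j ->
  (x \in S) != (update x a \in S) -> (y \in S) != (update y b \in S) ->
  ~ MIS_normal E.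
Proof.
move=> mS ij xa yb /(_ S mS)[k [I [_ eS]]]; move: xa yb.
have [ik|/update_out ik] := eqVneq i k; last by rewrite eS !inE ik eqxx.
by rewrite ik in ij; rewrite eS !inE (update_out y b) ?eqxx // eq_sym.
Qed.

Hypothesis vtE : forall i, vt_graph (@E i).
Local Notation ratio i := (indep_ratio (@E i)).

(** The factors not listed are added by pulling back, and the resulting order covers all indices. *)
Lemma max_independent_extend i0 s (Q : {set iter_prod T i0 s}) :
  uniq (i0 :: s) -> (forall k, (ratio k <= ratio i0)%R) ->
  max_independent (iter_rel E (s:=s)) Q ->
  exists2 S, max_independent (prod_rel E) S
    & forall x, (x \in S) = (restrict i0 s x \in Q).
Proof.
move=> us le mQ; pose s' := [seq k <- enum 'I_n | k \notin i0 :: s].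
have cover : perm_eq (i0 :: s' ++ s) (enum 'I_n).
  have pm : perm_eq (i0 :: s' ++ s) (s' ++ i0 :: s) by rewrite -cat1s -[_ :: s]cat1s perm_catCA.
  rewrite (perm_trans pm) // uniq_perm ?enum_uniq //.
    rewrite cat_uniq us filter_uniq ?enum_uniq // andbT.
    by apply/hasPn => k ks; rewrite /= /s' mem_filter ks.
  move=> k; rewrite mem_cat /s' mem_filter !mem_enum andbT.
  by case: (k \in i0 :: s).
have [Q' mQ' eQ] := max_independent_lift vtE (s':=s') (fun k _ => le k) mQ.
exists [set x | restrict i0 (s' ++ s) x \in Q'].
  exact: max_independent_restrict.
by move=> x; rewrite inE eQ.
Qed.

Lemma prod_vertex_inhabited : exists x : prod_vertex T, True.
Proof.
have T0 k : 0 < #|T k| by case: (vtE k).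
by exists [ffun k => enum_val (Ordinal (T0 k))].
Qed.

Lemma imprimitive_not_normal i j : i != j -> ratio j = ratio i ->
  (ratio i < 1)%R -> (forall k, (ratio k <= ratio i)%R) ->
  IS_imprimitive (@E i) -> ~ MIS_normal E.
Proof.
move=> ij rji ri1 le [A impA].
have [M mM] := alpha_witness (@E j).
have mQ := max_independent_mixed (vtE i) (vtE j) rji ri1 impA mM.
have [|S mS eS] := @max_independent_extend i [:: j] _ _ le mQ.
  by rewrite /= inE ij.
have {}eS x : (x \in S) = (x i \in A) || (x i \notin cnbhd (@E i) A) && (x j \in M).
  by rewrite eS [LHS]in_set.
have cA := imprimitive_card impA; have [/set0Pn[a aA] iA ltA _] := impA.
have [b eab] := vt_nonisolated (vtE i) a ri1.
have bN : b \in cnbhd (@E i) A by apply/setUP; left; apply/nbhdP; exists a.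
have bA : b \notin A.
  by apply/negP => bA; have /independentP/(_ a b aA bA) := iA; rewrite eab.
have [[_ irri] _ Ti0] := vtE i; have [[_ irrj] _ Tj0] := vtE j.
(* If N[A] were everything, tightness would give |A| = alpha. *)
have [c cN] : exists c, c \notin cnbhd (@E i) A.
  apply/existsP; rewrite -negb_forall; apply/negP => /forallP all.
  have NT : cnbhd (@E i) A = setT by apply/setP => k; rewrite all inE.
  move: cA; rewrite NT cardsT -indep_ratioE // => /eqP; rewrite eqr_nat => /eqP cA.
  by move: ltA; rewrite cA ltnn.
have cA' : c \notin A by apply: contra cN; apply: (subsetP (sub_cnbhd _ _)).
have /andP[_ /eqP cM] := mM.
have [d dM] : exists d, d \in M by apply/card_gt0P; rewrite cM alpha_gt0.
have rj1 : (ratio j < 1)%R by rewrite rji.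
have [d' d'M] : exists d', d' \notin M.
  apply/existsP; rewrite -negb_forall; apply/negP => /forallP all.
  have := alpha_lt_card (vtE j) rj1; rewrite -cM -cardsT ltnNge subset_leq_card //.
  by apply/subsetP => k _; apply: all.
have [x0 _] := prod_vertex_inhabited.
have ji : j != i by rewrite eq_sym.
(* Coordinate i alone decides between a in A and b in N(A) outside A; over c outside N[A],
   coordinate j decides between d in M and d' outside M. *)
apply: (two_coordinates_not_normal mS ij (x := update x0 a) (a := b)
  (y := update (update x0 c) d) (b := d')).
  by rewrite !eS !update_in aA bN (negPf bA).
rewrite !eS !update_in !(update_out _ _ ji) !update_in (negPf cA') cN dM.
by rewrite (negPf d'M).
Qed.

Lemma three_halves_not_normal i j k : uniq [:: i; j; k] ->
  (ratio i = 1 / 2%:R)%R -> (ratio j = 1 / 2%:R)%R -> (ratio k = 1 / 2%:R)%R ->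
  (forall m, (ratio m <= ratio i)%R) -> ~ MIS_normal E.
Proof.
move=> uijk ri rj rk le.
have [M mM] := alpha_witness (@E i); have [N mN] := alpha_witness (@E j).
have [P mP] := alpha_witness (@E k).
have mQ := max_independent_majority (vtE i) (vtE j) (vtE k) ri rj rk mM mN mP.
move: (uijk); rewrite /= !inE negb_or !andbT => /andP[/andP[ij ik] jk].
have [|S mS eS] := @max_independent_extend i [:: k; j] _ _ le mQ.
  by rewrite /= !inE negb_or ik ij eq_sym jk.
have {}eS x : (x \in S) = majority (x i \in M) (x j \in N) (x k \in P).
  by rewrite eS [LHS]in_set.
have split_half m (L : {set T m}) : ratio m = (1 / 2%:R)%R -> max_independent (@E m) L ->
    (exists a, a \in L) /\ (exists b, b \notin L).
  move=> rm mL; have rm1 : (ratio m < 1)%R by rewrite rm.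
  have [[_ irr] _ T0] := vtE m.
  have /andP[_ /eqP cL] := mL.
  have [a aL] : exists a, a \in L by apply/card_gt0P; rewrite cL alpha_gt0.
  split; first by exists a.
  have [b eab] := vt_nonisolated (vtE m) a rm1.
  by exists b; rewrite (half_flip (vtE m) rm mL eab) aL.
have [[a aM] [a' a'M]] := split_half _ _ ri mM.
have [[b bN] [b' b'N]] := split_half _ _ rj mN.
have [_ [c' c'P]] := split_half _ _ rk mP.
have [x0 _] := prod_vertex_inhabited.
(* A bare majority: coordinates i and j vote for, k against, so changing either i or j loses it. *)
pose x := update (update (update x0 a) b) c'.
have ji : j != i by rewrite eq_sym.
have ki : k != i by rewrite eq_sym.
have kj : k != j by rewrite eq_sym.
have xi : x i = a by rewrite /x !(update_out _ _ ki) !(update_out _ _ ji) update_in.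
have xj : x j = b by rewrite /x !(update_out _ _ kj) update_in.
have xk : x k = c' by rewrite /x update_in.
apply: (two_coordinates_not_normal mS ij (x := x) (a := a') (y := x) (b := b')).
  rewrite !eS update_in !(update_out _ _ ij) !(update_out _ _ ik) xi xj xk.
  by rewrite aM bN (negPf a'M) (negPf c'P).
rewrite !eS update_in !(update_out _ _ ji) !(update_out _ _ jk) xi xj xk.
by rewrite aM bN (negPf b'N) (negPf c'P).
Qed.

End Coordinates.

(** * The characterisation of MIS-normality *)

Local Open Scope ring_scope.

Theorem theorem3p4 (n l : nat) (T : 'I_n -> finType) (E : forall i, rel (T i))
  (Hn : (2 <= n)%N) (Hl1 : (1 <= l)%N) (Hln : (l <= n)%N)
  (Hne : forall i, (0 < #|T i|)%N)
  (Hsimple : forall i, simple_graph (E i))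
  (Hconn : forall i, connected_graph (E i))
  (Hvt : forall i, vertex_transitive (E i))
  (Hhalf : forall i : 'I_n, (i < l)%N -> indep_ratio (E i) <= 1 / 2%:R)
  (Heq : forall i j : 'I_n, (i < l)%N -> (j < l)%N ->
           indep_ratio (E i) = indep_ratio (E j))
  (Hlt : forall i j : 'I_n, (i < l)%N -> (l <= j)%N ->
           indep_ratio (E j) < indep_ratio (E i))
  (Hmono : forall i j : 'I_n, (l <= i)%N -> (i <= j)%N ->
           indep_ratio (E j) <= indep_ratio (E i)) :
  MIS_normal E <->
  ((forall i : 'I_n, (i < l)%N -> indep_ratio (E i) < 1 / 2%:R) /\
     ((1 < l)%N -> forall i : 'I_n, (i < l)%N -> IS_primitive (E i)))
  \/
  ((forall i : 'I_n, (i < l)%N -> indep_ratio (E i) = 1 / 2%:R) /\ (l <= 2)%N).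
Proof.
have vtE i : vt_graph (E i) by split.
have le (i k : 'I_n) : (i < l)%N -> indep_ratio (E k) <= indep_ratio (E i).
  by move=> il; case: (ltnP k l) => kl; [rewrite (Heq k i)|apply/ltW/Hlt].
(* Indices start at 0, so [i0] is the first graph, which has the largest ratio. *)
pose i0 := Ordinal (ltnW Hn).
split=> [norm|cond].
  have [half|nhalf] := eqVneq (indep_ratio (E i0)) (1 / 2%:R).
    right; split=> [i il|]; first by rewrite (Heq i i0).
    rewrite leqNgt; apply/negP => l3.
    have n3 := leq_trans l3 Hln.
    pose i1 := Ordinal (ltnW n3); pose i2 := Ordinal n3.
    have il1 : (i1 < l)%N by apply: ltnW.
    apply: (@three_halves_not_normal n T E vtE i0 i1 i2) norm => //.
    - by rewrite (Heq i1 i0).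
    - by rewrite (Heq i2 i0).
    - by move=> m; apply: le.
  left; have lt_half (i : 'I_n) : (i < l)%N -> indep_ratio (E i) < 1 / 2%:R.
    by move=> il; rewrite (Heq i i0) // lt_neqAle nhalf Hhalf.
  split=> // l2 i il imp; pose i1 := Ordinal Hn.
  (* As 1 < l, a second factor of the same ratio exists to be mixed with the imprimitive one. *)
  have [j ij jl] : exists2 j : 'I_n, i != j & (j < l)%N.
    by have [->|ii0] := eqVneq i i0; [exists i1 | exists i0].
  apply: (@imprimitive_not_normal n T E vtE i j) norm => //.
  - exact: Heq.
  - by apply: lt_trans (lt_half i il) _.
  - by move=> m; apply: le.
(* The factors are reordered: [i0] innermost, then the others of largest ratio, and outermost those
   of smaller ratio. *)
pose s := [seq k : 'I_n <- enum 'I_n | (k < l)%N && (k != i0)].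
pose s' := [seq k : 'I_n <- enum 'I_n | (l <= k)%N].
have mems (k : 'I_n) : (k \in s) = (k < l)%N && (k != i0).
  by rewrite mem_filter mem_enum andbT.
have mems' (k : 'I_n) : (k \in s') = (l <= k)%N by rewrite mem_filter mem_enum andbT.
have cover : perm_eq (i0 :: s' ++ s) (enum 'I_n).
  rewrite uniq_perm ?enum_uniq //.
    rewrite cons_uniq cat_uniq mem_cat; apply/and4P; split.
    - by rewrite mems mems' eqxx andbF orbF leqNgt Hl1.
    - by rewrite filter_uniq // enum_uniq.
    - by apply/hasPn => k; rewrite mems /= mems' => /andP[kl _]; rewrite leqNgt kl.
    - by rewrite filter_uniq // enum_uniq.
  move=> k; rewrite in_cons mem_cat mems mems' mem_enum leqNgt.
  by case: (k < l)%N; rewrite ?orbT //= orbN.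
have smem (k : 'I_n) : k \in s -> (k < l)%N by rewrite mems => /andP[].
apply: iter_normal_MIS_normal cover _.
apply: (iter_normal_lt vtE) => //.
- case: cond => [[lth prim]|[half l2]].
    have [l2|l1] := ltnP 1 l.
      have [||//] := @iter_normal_primitive n T E i0 vtE s Hconn; first exact: lth.
      move=> i; rewrite inE => /orP[/eqP->|/smem il]; split; by [apply: Heq|apply: prim].
    (* For l = 1 no other factor shares the largest ratio. *)
    suff -> : s = [::] by apply: iter_normal0.
    apply/eqP; rewrite -size_eq0 size_filter -leqn0 leqNgt -has_count.
    apply/hasPn => k _; rewrite negb_and negbK orbC -val_eqE /=.
    by case: (posnP k) => //= k0; rewrite -leqNgt; apply: leq_trans l1 k0.
  (* With l <= 2 the list [s] can contain only index 1, so at most one further factor has ratio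
     1/2. *)
  case Es: s => [|j s1]; first exact: iter_normal0.
  have -> : s1 = [::].
    have : uniq (j :: s1) by rewrite -Es filter_uniq // enum_uniq.
    case: s1 Es => // k s1 Es; rewrite /= inE negb_or => /andP[/andP[jk _] _].
    have ms m : m \in [:: j, k & s1] -> val m = 1%N.
      rewrite -Es mems -val_eqE /= => /andP[ml m0].
      by move: (leq_trans ml l2) m0; case: (val m) => [|[]].
    by case/eqP: jk; apply: val_inj; rewrite !ms // !inE eqxx ?orbT.
  have jl : (j < l)%N by apply: smem; rewrite Es inE eqxx.
  have prim (i : 'I_n) : (i < l)%N -> IS_primitive (E i).
    by move=> il; apply: half_primitive => //; apply: half.
  (* The iterated product over the empty list is [E i0] itself, so this is the case of two primitive
     factors. *)
  have [] := iter_normal_eq vtE (s := [::]) (i0 := i0) (j := j) => //.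
  + by rewrite (Heq j i0).
  + exact: iter_normal0.
  + exact: prim.
  + exact: prim.
- by move=> i _; apply: le.
- by move=> i; rewrite mems' => li; apply: Hlt.
Qed.
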